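(* Let $n\geq 3$ and let $\Omega$ be a bounded domain in $\mathbb{R}^n$. Let $\varphi\in C^{0,1}(\partial\Omega)$ and let $\theta\in C^{0,1}(\overline{\Omega})$ with $\theta(x)\in\left(-\frac{n\pi}{2},\frac{n\pi}{2}\right)$. Let $u\in C^3(\Omega)\cap C^{0,1}(\overline{\Omega})$ be a solution of the Dirichlet problem $$\begin{cases} F(D^2u)=\theta(x) & \text{in }\Omega,\\ u=\varphi & \text{on }\partial\Omega,\end{cases}$$ where $F(D^2u)=\sum_{i=1}^n\arctan(\lambda_i)$ and $\lambda_1,\dots,\lambda_n$ are the eigenvalues of $D^2u$. Then $$\max_{\overline{\Omega}}|\nabla u|\leq C\left(1+\max_{\partial\Omega}|\nabla u|\right),$$ where $C$ depends only on $n$, $\|u\|_{L^\infty(\overline{\Omega})}$ and $\|\theta\|_{C^{0,1}(\overline{\Omega})}$.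
   Context: For a real symmetric $n\times n$ matrix $A$ with eigenvalues $\lambda_1,\dots,\lambda_n$ (with multiplicity), the Lagrangian phase operator is $F(A)=\sum_{i=1}^n\arctan(\lambda_i)$, with $\arctan$ taking values in $(-\frac{\pi}{2},\frac{\pi}{2})$. $\|\cdot\|_{C^{0,1}(\overline{\Omega})}$ is the sup norm plus the Lipschitz constant on $\overline{\Omega}$. For a boundary point $x_0\in\partial\Omega$, $|\nabla u|(x_0)$ is understood as $\limsup_{x\to x_0,\,x\in\Omega}|\nabla u(x)|$, which is finite since $u$ is Lipschitz. ''$C$ depends only on ...'' means that for each $n$ and each pair of bounds on the two norms listed, there is a single constant $C$ valid for all such $\Omega$, $u$, $\theta$, $\varphi$. *)

(* Defs.v *)
From HB Require Import structures.
From mathcomp Require Import all_boot all_order all_algebra.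
From mathcomp Require Import all_classical all_reals all_analysis.
From mathcomp Require complex.

Set Implicit Arguments.
Unset Strict Implicit.
Unset Printing Implicit Defensive.

Import Order.TTheory GRing.Theory Num.Theory.
Import numFieldNormedType.Exports.

Local Open Scope classical_set_scope.
Local Open Scope ring_scope.

Section Phase.
Context {R : realType} {n : nat}.
Implicit Type A : 'M[R]_n.

(* If the characteristic polynomial does not split over R, this is the junk
   value 0; by char_poly_eigenvals below this never happens for symmetric A. *)
Definition eigenvals A : 'rV[R]_n :=
  xget 0 [set l : 'rV[R]_n | char_poly A = \prod_(i < n) ('X - (l 0 i)%:P)].

Definition lagrangian_phase A : R := \sum_(i < n) atan (eigenvals A 0 i).

End Phase.

Section EigenvalsSymmetric.
Import complex.

Lemma char_poly_eigenvals (R : realType) (n : nat) (A : 'M[R]_n) :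
  A^T = A -> char_poly A = \prod_(i < n) ('X - (eigenvals A 0 i)%:P).
Proof.
move=> As; rewrite /eigenvals; case: xgetP => [l _ //|/= noP]; exfalso.
pose f : {rmorphism R -> R[i]} := @real_complex R.
pose B := map_mx f A.
have fP (z : R[i]) : z \is Num.real -> z = f (Re z).
  by move=> /Creal_ImP; case: z => a b; rewrite -complexIm /= => -[->].
have Bh : B \is hermsymmx.
  apply: realsym_hermsym.
    by apply/is_hermitianmxP; rewrite expr0 scale1r map_mx_id // /B -[in LHS]As map_trmx.
  by apply/mxOverP => i j; rewrite mxE /= complex_real.
have /orthomx_spectralP := hermitian_normalmx Bh.
set P := spectralmx B; set d := spectral_diag B => BE.
have dR i : d 0 i = f (Re (d 0 i)).
  by apply: fP; have /mxOverP := hermitian_spectral_diag_real Bh.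
have Pu : P \in unitmx := spectral_unit B.
have cB : char_poly B = \prod_(i < n) ('X - (d 0 i)%:P).
  rewrite /char_poly /char_poly_mx BE.
  have -> : 'X%:M - map_mx polyC (invmx P *m diag_mx d *m P) =
      map_mx polyC (invmx P) *m ('X%:M - map_mx polyC (diag_mx d)) *m
      map_mx polyC P.
    rewrite mulmxBr mulmxBl -!map_mxM mul_mx_scalar -scalemxAl -map_mxM mulVmx //.
    by rewrite map_mx1 scalemx1.
  rewrite !det_mulmx mulrAC -det_mulmx -map_mxM mulVmx // map_mx1 det1 mul1r.
  rewrite -/(char_poly_mx _) -/(char_poly _) char_poly_trig ?diag_mx_is_trig //.
  by apply: eq_bigr => i _; rewrite mxE eqxx.
apply: (noP (\row_i Re (d 0 i))) => /=.
apply: (@map_poly_inj _ _ f); rewrite map_char_poly -/B cB rmorph_prod /=.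
by apply: eq_bigr => i _; rewrite rmorphB /= map_polyX map_polyC /= mxE -dR.
Qed.

End EigenvalsSymmetric.

Section Euclidean.
Context {R : realType} {n : nat}.
Local Notation E := 'rV[R]_n.
Implicit Types (A Omega : set E) (f u : E -> R).

(* The library norm on row vectors is the sup norm, not the Euclidean one. *)
Definition eucl_norm (v : E) : R := Num.sqrt (\sum_(i < n) v 0 i ^+ 2).

Definition pderiv (i : 'I_n) f : E -> R := 'D_(delta_mx 0 i) f.

Definition grad u (x : E) : E := \row_(i < n) pderiv i u x.

Definition hessian u (x : E) : 'M[R]_n :=
  \matrix_(i < n, j < n) pderiv j (pderiv i u) x.

(* All partial derivatives of order at most k exist and are continuous on Omega;
   Omega is meant to be open. *)
Fixpoint Ck (k : nat) Omega f : Prop :=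
  {in Omega, continuous f} /\
  if k is k'.+1 then
    forall i : 'I_n, (forall x, Omega x -> derivable f x (delta_mx 0 i)) /\
                     Ck k' Omega (pderiv i f)
  else True.

Definition sup_norm A f : \bar R := ereal_sup [set `|f x|%:E | x in A].

(* The pairs (x, x) contribute 0 / 0 = 0. *)
Definition lip_const A f : \bar R :=
  ereal_sup [set (`|f p.1 - f p.2| / eucl_norm (p.1 - p.2))%:E | p in A `*` A].

Definition C01_norm A f : \bar R := (sup_norm A f + lip_const A f)%E.

Definition C01 A f : Prop := (C01_norm A f < +oo)%E.

Definition bounded_domain Omega : Prop :=
  [/\ Omega !=set0, open Omega, connected Omega & bounded_set Omega].

Definition boundary Omega : set E := closure Omega `\` interior Omega.

(* At a boundary point: the limsup of the gradient norm from inside Omega. *)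
Definition grad_norm Omega u (x : E) : \bar R :=
  if x \in Omega then (eucl_norm (grad u x))%:E
  else limf_esup (fun y => (eucl_norm (grad u y))%:E) (within Omega (nbhs x)).

End Euclidean.

(* Main.v *)
Require Import Defs.
From mathcomp Require Import all_boot all_order all_algebra.
From mathcomp Require Import all_classical all_reals all_analysis.
From mathcomp Require Import perm.
From mathcomp Require complex.
From mathcomp Require Import ring lra.
Import Order.TTheory GRing.Theory Num.Theory.
Import numFieldNormedType.Exports.
Set Implicit Arguments.
Unset Strict Implicit.
Unset Printing Implicit Defensive.
Local Open Scope classical_set_scope.
Local Open Scope ring_scope.

(** The estimate is a maximum principle for the energy [(|Du|^2 + u^2) / 2].

    Suppose that the energy is maximal over [Omega] at an interior point, and
    write [g = Du], [A = D^2 u] and [S = (1 + A^2)^-1] there; [S] is the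
    coefficient matrix of the linearised operator.  The first order condition is
    [g A = - u g], so [g] is an eigenvector of [A], hence of [S], and
    [g S g^T = |g|^2 / (1 + u^2)].  The second order condition says that
    [A^2 + B + g^T g + u A] is a nonpositive form, where [B] is the derivative of
    [A] in the direction [g].  Taking the trace against the positive matrix [S],
<<
      tr (S A^2) + tr (S B) + |g|^2 / (1 + u^2) + u tr (S A) <= 0.
>>
    The first term is nonnegative, and [|tr (S A)| <= n / 2].  The number
    [tr (S B)] is the derivative of the phase in the direction [g], so it is at
    most [K |g|] in absolute value when the phase is [K]-Lipschitz.  With [M] a
    bound for [|u|] this gives [|g|^2 / (1 + M^2) <= K |g| + M n / 2], which bounds
    [|g|] ([energy_max_gradient_bound]).

    The eigenvalues of [D^2 u] need not be differentiable, so the phase is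
    differentiated through the polynomial [det (i - A)], whose argument is the
    phase up to a constant because [i - l = sqrt (1 + l^2) i e^(i atan l)]
    ([det_i_sub_polar]).  Jacobi's formula gives its derivative, and
    [(i - A) (i + A) = - (1 + A^2)] turns the logarithmic derivative into a trace
    against [S] ([linearized_phase_bound]).

    There remains the case where no such maximum exists.  Let [b] bound the
    gradient near the boundary and [C1] bound it at interior maxima of the energy.
    If [|Du|] exceeds [max b C1 + M] at some point, then, [u^2] being at most
    [M^2], it exceeds [max b C1] on the whole superlevel set of the energy through
    that point; this set stays away from the boundary, so it is compact, and the
    energy has an interior maximum at which [|Du|] is larger than [C1], a
    contradiction ([gradient_maximum_principle]). *)

(** * Directional derivatives in a normed space *)

Section DirectionalCalculus.
Context {R : realType} {V : normedModType R}.
Implicit Types (f g df : V -> R) (x v w : V).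

(** The form without a quotient: the increment [h = 0] needs no separate care. *)
Lemma is_deriveP f x v d : is_derive x v f d <->
  forall e, 0 < e -> exists2 r : R, 0 < r & forall h, `|h| < r ->
    `|f (h *: v + x) - f x - h * d| <= e * `|h|.
Proof.
have mulE h : h != 0 -> `|f (h *: v + x) - f x - h * d| =
    `|d - h^-1 * (f (h *: v + x) - f x)| * `|h|.
  move=> h0; rewrite -normrM distrC mulrBl -mulrA mulrCA mulVf //.
  by rewrite mulr1 mulrC.
split=> [[df dfE] e e0|fd].
  have /cvgrPdist_le /(_ e e0) := df; rewrite -/('D_v f x) dfE => /nbhs_ballP[r /= r0 rP].
  exists r => // h hr; have [->|h0] := eqVneq h 0.
    by rewrite scale0r add0r mul0r !subrr normr0 mulr0.
  rewrite mulE //; apply: ler_wpM2r => //; apply: rP => //.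
  by rewrite -ball_normE /= sub0r normrN.
have cf : (fun h => h^-1 *: ((f \o shift x) (h *: v) - f x)) @ 0^' --> d.
  apply/cvgrPdist_le => e e0; have [r r0 rP] := fd e e0.
  apply/nbhs_ballP; exists r => //= h; rewrite -ball_normE /= sub0r normrN => hr h0.
  by have := rP h hr; rewrite mulE // ler_pM2r // normr_gt0.
by apply: DeriveDef; [apply/cvg_ex; exists d|exact: cvg_lim cf].
Qed.

Lemma is_deriveZdir f x v d c :
  is_derive x v f d -> is_derive x (c *: v) f (c * d).
Proof.
move=> /is_deriveP fd; apply/is_deriveP => e e0.
have c1 : 0 < `|c| + 1 by rewrite ltr_wpDl.
have [r r0 rP] := fd (e / (`|c| + 1)) (divr_gt0 e0 c1).
exists (r / (`|c| + 1)) => [|h]; first exact: divr_gt0.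
rewrite ltr_pdivlMr // => hr; rewrite scalerA mulrA.
have /rP : `|h * c| < r.
  by rewrite normrM (le_lt_trans _ hr) // ler_wpM2l // lerDl.
move=> /le_trans; apply; rewrite normrM mulrAC ler_pdivrMr // -mulrA.
by apply: ler_wpM2l; [exact: ltW|apply: ler_wpM2l; rewrite // lerDl].
Qed.

Lemma is_derive_line f x v d t :
  is_derive (t *: v + x) v f d -> is_derive t (1 : R) (fun s => f (s *: v + x)) d.
Proof.
have E : (fun h => h^-1 *: (((fun s => f (s *: v + x)) \o shift t) (h *: (1 : R)) -
      f (t *: v + x))) =
    (fun h => h^-1 *: ((f \o shift (t *: v + x)) (h *: v) - f (t *: v + x))).
  by apply/funext => h /=; rewrite scalerDl addrA [h%:A]mulr1.
by move=> [fd fdE]; apply: DeriveDef; rewrite /derivable /derive E.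
Qed.

Lemma is_derive_translate f x v d y :
  is_derive (x + y) v f d -> is_derive x v (fun z => f (z + y)) d.
Proof.
move=> /is_deriveP fd; apply/is_deriveP => e /fd[r r0 rP].
by exists r => // h /rP; rewrite addrA.
Qed.

Lemma MVT_dir f df x v :
  (forall s : R, 0 <= s <= 1 -> is_derive (s *: v + x) v f (df (s *: v + x))) ->
  exists2 s : R, 0 < s < 1 & f (v + x) - f x = df (s *: v + x).
Proof.
move=> fd; have fl (s : R) : 0 <= s <= 1 ->
    is_derive s (1 : R) (fun s => f (s *: v + x)) (df (s *: v + x)).
  by move=> /fd; exact: is_derive_line.
have [||s] := @MVT R (fun s => f (s *: v + x)) (fun s => df (s *: v + x)) 0 1 ltr01.
- by move=> s; rewrite in_itv /= => /andP[s0 s1]; apply: fl; rewrite !ltW.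
- apply: derivable_within_continuous => s; rewrite in_itv /= => s01.
  by have [] := fl s s01.
rewrite in_itv /= => s01; rewrite scale1r scale0r add0r subr0 mulr1 => E.
by exists s.
Qed.

(** Along [h *: v] then [h *: w]: the first step contributes the derivative at
    [x] itself, the second, by the mean value theorem, the derivative in
    direction [w] at a nearby point; continuity of the latter suffices. *)
Lemma is_derive_dirD f df x v w d r : 0 < r ->
  (forall y, `|y - x| < r -> is_derive y w f (df y)) ->
  {for x, continuous df} -> is_derive x v f d ->
  is_derive x (v + w) f (d + df x).
Proof.
move=> r0 fw /cvgrPdist_le cdf /is_deriveP fv; apply/is_deriveP => e e0.
have e20 : 0 < e / 2 by rewrite divr_gt0.
have [r1 r10 fv1] := fv _ e20.
have /nbhs_ballP[r2 /= r20 cd] := cdf _ e20.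
(* The added 1 keeps the divisor positive when both directions vanish. *)
pose m := `|v| + `|w| + 1.
have m0 : 0 < m by rewrite ltr_wpDl // addr_ge0.
pose q := Num.min r1 (Num.min r r2 / m).
exists q => [|h]; first by rewrite lt_min r10 divr_gt0 // lt_min r0.
rewrite lt_min => /andP[h1]; rewrite ltr_pdivlMr // lt_min => /andP[hr hr2].
have close (s : R) : 0 <= s <= 1 -> `|s *: (h *: w) + (h *: v + x) - x| <= `|h| * m.
  move=> /andP[s0 s1]; rewrite addrA addrK (le_trans (ler_normD _ _)) // !normrZ.
  rewrite mulrDr mulr1 mulrDr; apply: ler_wpDr => //; rewrite addrC lerD2l.
  by rewrite ger0_norm // ler_piMl // mulr_ge0.
have [s|s s01 E] := @MVT_dir f (fun y => h * df y) (h *: v + x) (h *: w).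
  move=> /close sc; apply: is_deriveZdir; apply: fw; exact: le_lt_trans sc hr.
have {}s01 : 0 <= s <= 1 by case/andP: s01 => *; rewrite !ltW.
have /cd E2 : ball x r2 (s *: (h *: w) + (h *: v + x)).
  by rewrite -ball_normE /= distrC (le_lt_trans (close _ s01)).
rewrite scalerDr (addrC (h *: v)) -(addrA (h *: w)) mulrDr.
rewrite -[f (h *: w + _)](subrK (f (h *: v + x))) E.
set y := s *: _ + _ in E2 *.
rewrite (_ : _ - _ - _ = f (h *: v + x) - f x - h * d - h * (df x - df y)); last by ring.
rewrite (le_trans (ler_normB _ _)) // [e]splitr mulrDl lerD ?fv1 //.
by rewrite normrM mulrC ler_wpM2r.
Qed.

(** The second difference is the increment along [v] of [y |-> f (y + w) - f y];
    two applications of the mean value theorem turn it into a second derivative. *)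
Lemma second_difference_mvt f fv fvw x v w r :
  (forall y, `|y - x| < r -> is_derive y v f (fv y)) ->
  (forall y, `|y - x| < r -> is_derive y w fv (fvw y)) ->
  `|v| + `|w| < r ->
  exists2 y, `|y - x| < r &
    f (w + (v + x)) - f (v + x) - (f (w + x) - f x) = fvw y.
Proof.
move=> fvP fvwP vwr.
have close (s t : R) : 0 <= s <= 1 -> 0 <= t <= 1 -> `|t *: w + (s *: v + x) - x| < r.
  move=> /andP[s0 s1] /andP[t0 t1]; rewrite addrA addrK.
  rewrite (le_lt_trans (ler_normD _ _)) // !normrZ (le_lt_trans _ vwr) //.
  by rewrite addrC !ger0_norm // lerD // ler_piMl.
have z01 : 0 <= (0 : R) <= 1 by rewrite lexx ler01.
have o01 : 0 <= (1 : R) <= 1 by rewrite lexx ler01.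
have [s s01|s s01 E] := @MVT_dir (fun y => f (y + w) - f y)
    (fun y => fv (y + w) - fv y) x v.
  apply: is_deriveB.
    apply: is_derive_translate; apply: fvP; rewrite (addrC _ w).
    by have := close s 1 s01 o01; rewrite scale1r.
  by apply: fvP; have := close s 0 s01 z01; rewrite scale0r add0r.
have {}s01 : 0 <= s <= 1 by case/andP: s01 => *; rewrite !ltW.
have [t t01|t t01 E2] := @MVT_dir fv fvw (s *: v + x) w.
  by apply: fvwP; exact: close.
have {}t01 : 0 <= t <= 1 by case/andP: t01 => *; rewrite !ltW.
exists (t *: w + (s *: v + x)); first exact: close.
by rewrite -E2 [w + (s *: v + x)]addrC -E [w + _]addrC [w + x]addrC.
Qed.

(** Schwarz's theorem.  The second difference along [h v] and [h w] is symmetric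
    in the two directions, and divided by [h^2] it is a value of either mixed
    derivative at a point close to [x]. *)
Lemma mixed_derive_sym f fv fw fvw fwv x v w r : 0 < r ->
  (forall y, `|y - x| < r -> is_derive y v f (fv y)) ->
  (forall y, `|y - x| < r -> is_derive y w f (fw y)) ->
  (forall y, `|y - x| < r -> is_derive y w fv (fvw y)) ->
  (forall y, `|y - x| < r -> is_derive y v fw (fwv y)) ->
  {for x, continuous fvw} -> {for x, continuous fwv} -> fvw x = fwv x.
Proof.
move=> r0 fvP fwP fvwP fwvP /cvgrPdist_lt cvw /cvgrPdist_lt cwv.
apply/eqP; rewrite -subr_eq0 -normr_le0; apply/ler_addgt0Pl => e e0; rewrite addr0.
have e20 : 0 < e / 2 by rewrite divr_gt0.
have /nbhs_ballP[r1 /= r10 c1] := cvw _ e20.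
have /nbhs_ballP[r2 /= r20 c2] := cwv _ e20.
pose q := Num.min r (Num.min r1 r2).
have q0 : 0 < q by rewrite !lt_min r0 r10.
have qr y : `|y - x| < q -> `|y - x| < r by rewrite lt_min => /andP[].
pose m := `|v| + `|w| + 1.
have m0 : 0 < m by rewrite ltr_wpDl // addr_ge0.
pose h := q / m; have h0 : 0 < h by exact: divr_gt0.
have hvw : `|h *: v| + `|h *: w| < q.
  rewrite (normrZ h v) (normrZ h w) (gtr0_norm h0) -mulrDr /h mulrAC ltr_pdivrMr //.
  by rewrite ltr_pM2l // ltrDl.
have [||y yq Ey] := @second_difference_mvt f (fun y => h * fv y)
    (fun y => h * (h * fvw y)) x (h *: v) (h *: w) q _ _ hvw.
- by move=> y /qr yr; exact/is_deriveZdir/fvP.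
- by move=> y /qr yr; apply: is_deriveZdir; apply: is_deriveZ; exact: fvwP.
have [|||z zq Ez] := @second_difference_mvt f (fun y => h * fw y)
    (fun y => h * (h * fwv y)) x (h *: w) (h *: v) q.
- by move=> y0 /qr yr; exact/is_deriveZdir/fwP.
- by move=> y0 /qr yr; apply: is_deriveZdir; apply: is_deriveZ; exact: fwvP.
- by rewrite addrC.
have E : fvw y = fwv z.
  apply: (mulfI (lt0r_neq0 h0)); apply: (mulfI (lt0r_neq0 h0)).
  by rewrite -Ey -Ez [h *: w + (_ + _)]addrCA; ring.
have := c1 y; rewrite -ball_normE /= distrC => /(_ _)/ltW Hy.
have := c2 z; rewrite -ball_normE /= distrC => /(_ _)/ltW Hz.
have {}Hy : `|fvw x - fvw y| <= e / 2.
  by apply: Hy; move: yq; rewrite !lt_min => /and3P[].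
have {}Hz : `|fwv x - fwv z| <= e / 2.
  by apply: Hz; move: zq; rewrite !lt_min => /and3P[].
rewrite (_ : fvw x - fwv x = (fvw x - fvw y) - (fwv x - fwv z)); last first.
  by rewrite E; ring.
by rewrite (le_trans (ler_normB _ _)) // [e]splitr lerD.
Qed.

(** Were the second derivative positive, the first derivative, which vanishes at
    the maximum, would be positive just after it, and [f] would increase. *)
Lemma second_derivative_test f df x v d r : 0 < r ->
  (forall y, `|y - x| < r -> is_derive y v f (df y)) ->
  is_derive x v df d -> (forall y, `|y - x| < r -> f y <= f x) ->
  df x = 0 /\ d <= 0.
Proof.
move=> r0 fd /is_deriveP dfd fmax.
pose m := `|v| + 1; have m0 : 0 < m by rewrite ltr_wpDl.
have close (s : R) : `|s| < r / m -> `|s *: v + x - x| < r.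
  rewrite ltr_pdivlMr // addrK normrZ => /(le_lt_trans _); apply.
  by rewrite ler_wpM2l // lerDl.
have rm0 : 0 < r / m by exact: divr_gt0.
have dfx0 : df x = 0.
  have inI (s : R) : s \in `](- (r / m)), (r / m)[ -> `|s *: v + x - x| < r.
    by rewrite in_itv /= -ltr_norml => /close.
  have fl (s : R) : s \in `](- (r / m)), (r / m)[ ->
      is_derive s (1 : R) (fun s => f (s *: v + x)) (df (s *: v + x)).
    by move=> /inI /fd; exact: is_derive_line.
  have i0 : 0 \in `](- (r / m)), (r / m)[ by rewrite in_itv /= oppr_lt0 rm0.
  have [||||_] := @derive1_at_max R (fun s => f (s *: v + x)) (- (r / m)) (r / m) 0.
  - by apply: (@le_trans _ _ 0); rewrite ?oppr_le0 ltW.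
  - by move=> s /fl[].
  - exact: i0.
  - by move=> s /inI /fmax; rewrite scale0r add0r.
  by have [_ ->] := fl 0 i0; rewrite scale0r add0r.
split=> //; rewrite leNgt; apply/negP => d0.
have d20 : 0 < d / 2 by rewrite divr_gt0.
have [r1 r10 dP] := dfd _ d20.
pose h := Num.min (r / m) r1 / 2.
have h0 : 0 < h by rewrite divr_gt0 // lt_min rm0.
have [hr hr1] : h < r / m /\ h < r1.
  by apply/andP; rewrite -lt_min [ltRHS]splitr ltrDr.
have sh (s : R) : 0 <= s <= 1 -> `|s * h| < r / m /\ `|s * h| < r1.
  move=> /andP[s0 s1]; rewrite normrM !ger0_norm // ?ltW //.
  by split; [apply: le_lt_trans hr|apply: le_lt_trans hr1]; rewrite ler_piMl // ltW.
have [s s01|s /andP[s0 s1] E] := @MVT_dir f (fun y => h * df y) x (h *: v).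
  by apply/is_deriveZdir/fd; rewrite scalerA; apply: close; have [] := sh _ s01.
have [shr shr1] := sh s (introT andP (conj (ltW s0) (ltW s1))).
have sh0 : 0 < s * h by exact: mulr_gt0.
have : 0 < df (s *: (h *: v) + x).
  have := dP _ shr1; rewrite dfx0 subr0 ler_distl -scalerA => /andP[+ _].
  apply: lt_le_trans; rewrite gtr0_norm // [s * h * d]mulrC -mulrBl mulr_gt0 //; lra.
move=> /(mulr_gt0 h0); rewrite -E subr_gt0 ltNge => /negP; apply.
by apply: fmax; apply: close; rewrite gtr0_norm.
Qed.

End DirectionalCalculus.

(** * Traces against the inverse of [1 + A^2] *)

Section MetricTrace.
Context {R : realFieldType} {n : nat}.
Implicit Types (A B H X : 'M[R]_n) (g w : 'rV[R]_n).

Definition quad H w : R := (w *m H *m w^T) 0 0.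

(** When [A] is the Hessian of [u], [1 + A^2] is the metric that the Euclidean
    space of dimension [2 n] induces on the graph of [Du], and this inverse is the
    coefficient matrix of the linearised phase operator. *)
Definition metric_inv A : 'M[R]_n := invmx (1%:M + A *m A).

Lemma rowdot_ge0 m (w : 'rV[R]_m) : 0 <= (w *m w^T) 0 0.
Proof. by rewrite mxE sumr_ge0 // => i _; rewrite mxE -expr2 sqr_ge0. Qed.

Lemma rowdot_eq0 m (w : 'rV[R]_m) : (w *m w^T) 0 0 = 0 -> w = 0.
Proof.
rewrite mxE => /eqP; rewrite psumr_eq0 => [/allP w0|i _]; last first.
  by rewrite mxE -expr2 sqr_ge0.
apply/rowP => i; rewrite mxE; apply/eqP.
by have := w0 i (mem_index_enum _); rewrite mxE -expr2 sqrf_eq0.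
Qed.

Lemma mxtrace_congr_ge0 H X : (forall w, 0 <= quad H w) ->
  0 <= \tr (X *m H *m X^T).
Proof.
move=> H0; apply: sumr_ge0 => i _.
suff -> : (X *m H *m X^T) i i = quad H (row i X) by [].
rewrite /quad -row_mul [LHS]mxE [RHS]mxE.
by apply: eq_bigr => j _; rewrite tr_row [row _ _ _ _]mxE [col _ _ _ _]mxE.
Qed.

Section Symmetric.
Variable A : 'M[R]_n.
Hypothesis As : A^T = A.
Local Notation S := (metric_inv A).

Lemma unitmx_1DAA : 1%:M + A *m A \in unitmx.
Proof.
rewrite -row_free_unit -kermx_eq0; apply/rowV0P => v /sub_kermxP.
move=> /(congr1 (mulmx^~ v^T)); rewrite mul0mx mulmxDr mulmx1 mulmxDl => E.
have := congr1 (fun M : 'M[R]_1 => M 0 0) E; rewrite [LHS]mxE [in RHS]mxE.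
rewrite (_ : v *m (A *m A) *m v^T = v *m A *m (v *m A)^T); last first.
  by rewrite trmx_mul As !mulmxA.
move/eqP; rewrite paddr_eq0 ?rowdot_ge0 // => /andP[/eqP/rowdot_eq0 //].
Qed.

Lemma metric_invK : S *m (1%:M + A *m A) = 1%:M.
Proof. exact: mulVmx unitmx_1DAA. Qed.

Lemma trmx_metric_inv : S^T = S.
Proof.
by rewrite /metric_inv trmx_inv linearD /= trmx1 trmx_mul As.
Qed.

(** [S (1 + A^2) S = S] exhibits [S] as a sum of two Gram matrices. *)
Lemma metric_inv_gram : S = S *m S^T + (S *m A) *m (S *m A)^T.
Proof.
rewrite trmx_mul trmx_metric_inv As -[LHS]mul1mx -[1%:M in LHS]metric_invK.
by rewrite -mulmxA mulmxDl mulmxDr mul1mx !mulmxA.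
Qed.

(** A sum of Gram matrices [X X^T] has nonnegative trace against a nonnegative
    form, the trace of [X^T H X] being a sum of values of the form. *)
Lemma mxtrace_metric_inv_ge0 H : (forall w, 0 <= quad H w) -> 0 <= \tr (S *m H).
Proof.
move=> H0; rewrite [S in X in 0 <= X]metric_inv_gram mulmxDl linearD /= addr_ge0 //.
  by rewrite -mulmxA mxtrace_mulC -{2}[S]trmxK; exact: mxtrace_congr_ge0.
rewrite -mulmxA mxtrace_mulC -{2}[S *m A]trmxK; exact: mxtrace_congr_ge0.
Qed.

Lemma quad_sq m (B : 'M[R]_(n, m)) w : quad (B *m B^T) w = (w *m B *m (w *m B)^T) 0 0.
Proof. by rewrite /quad trmx_mul !mulmxA. Qed.

Lemma mxtrace_metric_inv_sq_ge0 B : 0 <= \tr (S *m (B *m B^T)).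
Proof.
by apply: mxtrace_metric_inv_ge0 => w; rewrite quad_sq rowdot_ge0.
Qed.

(** The numbers [l / (1 + l^2)] lie in [-1/2, 1/2]; in matrix form this is the
    nonnegativity of the trace of [S] against the squares of [1 + A] and [1 - A]. *)
Lemma norm_mxtrace_metric_invM : `|\tr (S *m A)| <= n%:R / 2.
Proof.
have sq (c : R) : c ^+ 2 = 1 -> 0 <= n%:R + 2 * c * \tr (S *m A).
  move=> c1; have := mxtrace_metric_inv_sq_ge0 (1%:M + c *: A).
  have -> : (1%:M + c *: A) *m (1%:M + c *: A)^T =
      (1%:M + A *m A) + (2 * c) *: A.
    rewrite linearD /= linearZ /= trmx1 As mulmxDl mul1mx mulmxDr mulmx1.
    rewrite -scalemxAl -scalemxAr scalerA -expr2 c1 scale1r mulr_natl mulr2n.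
    by rewrite scalerDl -!addrA; congr (_ + _); rewrite addrCA addrA addrC.
  by rewrite mulmxDr metric_invK -scalemxAr linearD linearZ /= mxtrace1.
have h1 := sq 1 (expr1n _ _).
have h2 : 0 <= n%:R + 2 * -1 * \tr (S *m A) by apply: sq; rewrite sqrrN expr1n.
by rewrite ler_norml; apply/andP; split; lra.
Qed.

(** The nonpositive form is the Hessian of the energy at an interior maximum, [a]
    being the value of [u].  Its trace against [S = metric_inv A] is at most 0, and
    [g A = - a g] makes [g] an eigenvector of [S], so that [g^T g] contributes the
    left-hand side; [A A] contributes a nonnegative number. *)
Lemma metric_inv_gradient_bound B g (a : R) :
  g *m A = - a *: g ->
  (forall w, quad (A *m A + B + g^T *m g + a *: A) w <= 0) ->
  (g *m g^T) 0 0 / (1 + a ^+ 2) <= `|\tr (S *m B)| + `|a| * (n%:R / 2).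
Proof.
move=> gA HP.
have a0 : 0 < 1 + a ^+ 2 by rewrite ltr_wpDr // sqr_ge0.
have gS : g *m S = (1 + a ^+ 2)^-1 *: g.
  have E : g *m (1%:M + A *m A) = (1 + a ^+ 2) *: g.
    rewrite mulmxDr mulmx1 mulmxA gA -scalemxAl gA scalerA mulrNN -expr2.
    by rewrite scalerDl scale1r.
  have := congr1 (mulmx^~ S) E.
  rewrite -mulmxA mulmxV ?unitmx_1DAA // mulmx1 -scalemxAl => {2}->.
  by rewrite scalerA mulVf ?scale1r // gt_eqF.
have T1 : 0 <= \tr (S *m (A *m A)).
  by have := mxtrace_metric_inv_sq_ge0 A; rewrite As.
have T3 : \tr (S *m (g^T *m g)) = (g *m g^T) 0 0 / (1 + a ^+ 2).
  rewrite mulmxA mxtrace_mulC mulmxA gS -scalemxAl linearZ /= mulrC.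
  by rewrite /mxtrace big_ord1.
have T4 : - (`|a| * (n%:R / 2)) <= a * \tr (S *m A).
  rewrite lerNl (le_trans (ler_norm _)) // normrN normrM ler_wpM2l //.
  exact: norm_mxtrace_metric_invM.
have TH : 0 <= \tr (S *m - (A *m A + B + g^T *m g + a *: A)).
  apply: mxtrace_metric_inv_ge0 => w; have := HP w.
  by rewrite -oppr_ge0 /quad mulmxN mulNmx => Hw; rewrite [leRHS]mxE.
move: TH; rewrite mulmxN !mulmxDr -scalemxAr linearN !linearD linearZ /= T3.
have : - `|\tr (S *m B)| <= \tr (S *m B) by rewrite lerNl -normrN ler_norm.
move: T1 T4; lra.
Qed.

End Symmetric.
End MetricTrace.

(** * The phase as the argument of [det (i - A)] *)

Section PhaseDerivative.
Import complex.
Local Open Scope complex_scope.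
Context {R : realType} {V : normedModType R}.
Implicit Types (x v : V).
Local Notation C := R[i].

(** Here [V] is a real space, so differentiability of a complex-valued function
    is that of its real and imaginary parts. *)
Definition is_cderive x v (F : V -> C) (d : C) :=
  is_derive x v (fun y => Re (F y)) (Re d) /\
  is_derive x v (fun y => Im (F y)) (Im d).

Lemma is_cderive_cst x v (c : C) : is_cderive x v (cst c) 0.
Proof. by split; exact: is_derive_cst. Qed.

Lemma is_cderiveD x v (F G : V -> C) d e :
  is_cderive x v F d -> is_cderive x v G e ->
  is_cderive x v (fun y => F y + G y) (d + e).
Proof.
move=> [F1 F2] [G1 G2].
have ReD (a b : C) : Re (a + b) = Re a + Re b by case: a b => ? ? [].
have ImD (a b : C) : Im (a + b) = Im a + Im b by case: a b => ? ? [].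
split; [under eq_fun do rewrite ReD|under eq_fun do rewrite ImD].
  by rewrite ReD; exact: is_deriveD.
by rewrite ImD; exact: is_deriveD.
Qed.

Lemma is_cderiveM x v (F G : V -> C) d e :
  is_cderive x v F d -> is_cderive x v G e ->
  is_cderive x v (fun y => F y * G y) (d * G x + F x * e).
Proof.
move=> [F1 F2] [G1 G2].
have ReM (a b : C) : Re (a * b) = Re a * Re b - Im a * Im b by case: a b => ? ? [].
have ImM (a b : C) : Im (a * b) = Re a * Im b + Im a * Re b by case: a b => ? ? [].
have ReD (a b : C) : Re (a + b) = Re a + Re b by case: a b => ? ? [].
have ImD (a b : C) : Im (a + b) = Im a + Im b by case: a b => ? ? [].
split; [under eq_fun do rewrite ReM|under eq_fun do rewrite ImM].
  apply: (is_derive_eq (is_deriveB (is_deriveM F1 G1) (is_deriveM F2 G2))).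
  by rewrite /GRing.scale /= ReD !ReM; ring.
apply: (is_derive_eq (is_deriveD (is_deriveM F1 G2) (is_deriveM F2 G1))).
by rewrite /GRing.scale /= ImD !ImM; ring.
Qed.

Lemma is_cderive_sum (I : Type) (r : seq I) x v (F : I -> V -> C) d :
  (forall i, is_cderive x v (F i) (d i)) ->
  is_cderive x v (fun y => \sum_(i <- r) F i y) (\sum_(i <- r) d i).
Proof.
move=> Fd; elim: r => [|i r IH].
  by rewrite big_nil; under eq_fun do rewrite big_nil; exact: is_cderive_cst.
by rewrite big_cons; under eq_fun do rewrite big_cons; exact: is_cderiveD.
Qed.

Lemma is_cderive_prod n x v (F : 'I_n -> V -> C) d :
  (forall i, is_cderive x v (F i) (d i)) ->
  is_cderive x v (fun y => \prod_i F i y)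
    (\sum_k d k * \prod_(i | i != k) F i x).
Proof.
elim: n F d => [|n IH] F d Fd.
  by rewrite big_ord0; under eq_fun do rewrite big_ord0; exact: is_cderive_cst.
under eq_fun do rewrite big_ord_recl.
have := is_cderiveM (Fd ord0) (IH _ _ (fun i => Fd (lift ord0 i))).
congr is_cderive; rewrite big_ord_recl; congr (_ + _).
  congr (_ * _); rewrite [in RHS]big_mkcond big_ord_recl eqxx /= mul1r.
  by apply: eq_bigr.
rewrite mulr_sumr; apply: eq_bigr => k _; rewrite mulrCA; congr (_ * _).
rewrite [in RHS]big_mkcond big_ord_recl /=; congr (_ * _).
by rewrite -big_mkcond; apply: eq_bigl => i; rewrite (inj_eq (@lift_inj _ _)).
Qed.

(** Jacobi's formula: the product rule in the Leibniz expansion yields, for each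
    [k], the determinant with row [k] differentiated, which is then expanded
    along that row. *)
Lemma is_cderive_det n x v (F : V -> 'M[C]_n) (D : 'M[C]_n) :
  (forall i j, is_cderive x v (fun y => F y i j) (D i j)) ->
  is_cderive x v (fun y => \det (F y)) (\tr (D *m \adj (F x))).
Proof.
move=> Fd; rewrite /determinant.
have Ps (s : {perm 'I_n}) : is_cderive x v
    (fun y => (-1) ^+ s * \prod_i F y i (s i))
    ((-1) ^+ s * \sum_k D k (s k) * \prod_(i | i != k) F x i (s i)).
  have := is_cderiveM (is_cderive_cst x v ((-1) ^+ s))
    (@is_cderive_prod n x v (fun i y => F y i (s i)) _ (fun i => Fd i (s i))).
  by rewrite mul0r add0r.
have := @is_cderive_sum _ (index_enum _) x v _ _ Ps.
congr is_cderive.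
under eq_bigr do rewrite mulr_sumr; rewrite exchange_big /=.
apply: eq_bigr => k _.
pose N := \matrix_(i, j) if i == k then D k j else F x i j.
transitivity (\det N).
  apply: eq_bigr => s _; congr (_ * _); rewrite [RHS](bigD1 k) //= mxE eqxx.
  by congr (_ * _); apply: eq_bigr => i /negPf ik; rewrite mxE ik.
rewrite (expand_det_row _ k) mxE; apply: eq_bigr => j _.
rewrite !mxE eqxx /cofactor; congr (_ * (_ * \det _)).
by apply/matrixP => i l; rewrite !mxE eq_sym (negPf (neq_lift _ _)).
Qed.

Definition cis (a : R) : C := cos a +i* sin a.

Lemma cisD a b : cis (a + b) = cis a * cis b.
Proof. by rewrite /cis cosD sinD; simpc; congr (_ +i* _); ring. Qed.

Lemma cis_sum n (f : 'I_n -> R) : cis (\sum_i f i) = \prod_i cis (f i).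
Proof. by apply: (big_morph cis cisD); rewrite /cis cos0 sin0. Qed.

Lemma i_sub_cis (l : R) :
  'i - l%:C = (Num.sqrt (1 + l ^+ 2))%:C * 'i * cis (atan l).
Proof.
have s0 : 0 < Num.sqrt (1 + l ^+ 2) by rewrite sqrtr_gt0 ltr_wpDr // sqr_ge0.
have c0 := cos_atan l.
have sE : sin (atan l) = l / Num.sqrt (1 + l ^+ 2).
  by rewrite -{2}[l]atanK /tan c0 invrK mulfK // gt_eqF.
rewrite /cis sE c0; simpc; congr (_ +i* _); first by rewrite mulrC divfK // gt_eqF.
by rewrite mulfV // gt_eqF.
Qed.

Definition det_i_sub n (A : 'M[R]_n) : C :=
  \det ('i%:M - map_mx (real_complex R) A).

(** The left-hand side is a polynomial in the entries of [A]: it stays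
    differentiable where eigenvalues collide, and it carries the phase. *)
Lemma det_i_sub_polar n (A : 'M[R]_n) : A^T = A ->
  exists2 rho : R, 0 < rho &
    det_i_sub A = rho%:C * 'i ^+ n * cis (lagrangian_phase A).
Proof.
move=> As.
exists (\prod_(k < n) Num.sqrt (1 + eigenvals A 0 k ^+ 2)).
  by apply: prodr_gt0 => k _; rewrite sqrtr_gt0 ltr_wpDr // sqr_ge0.
have -> : det_i_sub A = (char_poly (map_mx (real_complex R) A)).['i].
  rewrite /det_i_sub /char_poly -horner_evalE -det_map_mx; congr (\det _).
  apply/matrixP => i j; rewrite !mxE -[RHS]/(('X *+ (i == j) - ((A i j)%:C)%:P).['i]).
  rewrite hornerD hornerN hornerC.
  by rewrite hornerMn hornerX.
rewrite -map_char_poly char_poly_eigenvals // rmorph_prod horner_prod.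
rewrite /lagrangian_phase cis_sum rmorph_prod.
rewrite -[n in _ ^+ n]card_ord -prodr_const -!big_split /=.
apply: eq_bigr => k _; rewrite rmorphB /= map_polyX map_polyC /=.
by rewrite hornerD hornerN hornerX hornerC i_sub_cis.
Qed.

End PhaseDerivative.

(** * The derivative of the phase *)

Lemma norm_sin_le (R : realType) (t : R) : `|sin t| <= `|t|.
Proof.
have [s _|s _] := @MVT_dir R R^o (@sin R) (fun y => t * cos y) 0 t.
  have -> : t = t *: (1 : R) by rewrite /GRing.scale /= mulr1.
  have := @is_deriveZdir R R^o _ _ _ _ t (is_derive_sin (s *: (t *: (1 : R)) + 0)).
  by rewrite /GRing.scale /= !mulr1.
rewrite addr0 sin0 subr0 => ->.
by rewrite normrM ler_piMr // ler_norml cos_geN1 cos_le1.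
Qed.

Section LinearizedPhase.
Import complex.
Local Open Scope complex_scope.
Context {R : realType} {V : normedModType R} {n : nat}.
Implicit Types (x v : V) (A B : 'M[R]_n).
Local Notation emb := (map_mx (real_complex R)).

Lemma det_i_sub_neq0 A : A^T = A ->
  0 < Re (det_i_sub A) ^+ 2 + Im (det_i_sub A) ^+ 2.
Proof.
move=> As; have [rho rho0 ->] := det_i_sub_polar As.
have cis0 : cis (lagrangian_phase A) != 0.
  apply/eqP => -[c0 s0]; have := cos2Dsin2 (lagrangian_phase A).
  by move/eqP; rewrite c0 s0 expr0n addr0 eq_sym oner_eq0.
rewrite -ltcR add_Re2_Im2 exprn_gt0 // normr_gt0 !mulf_neq0 ?expf_neq0 //.
  by rewrite eq_complex /= gt_eqF.
by rewrite eq_complex /= oner_eq0 andbF.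
Qed.

(** The number [a d - b c] is the imaginary part of [conj z * z'] for
    [z = a + i b] and [z' = c + i d], whose argument is the difference of the two
    phases; and [|sin t| <= |t|]. *)
Lemma det_i_sub_phase A B : A^T = A -> B^T = B ->
  let: a +i* b := det_i_sub A in let: c +i* d := det_i_sub B in
  (a * d - b * c) ^+ 2 <= (a ^+ 2 + b ^+ 2) * (c ^+ 2 + d ^+ 2) *
    (lagrangian_phase B - lagrangian_phase A) ^+ 2.
Proof.
move=> As Bs.
have [rA _ EA] := det_i_sub_polar As; have [rB _ EB] := det_i_sub_polar Bs.
set s := lagrangian_phase A in EA *; set t := lagrangian_phase B in EB *.
case Ei : ('i ^+ n : R[i]) EA EB => [p q] EA EB.
have polarE (r u : R) : r%:C * (p +i* q) * cis u =
    (r * (p * cos u - q * sin u)) +i* (r * (p * sin u + q * cos u)).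
  by rewrite /cis; simpc; congr (_ +i* _); ring.
case: (det_i_sub A) EA => a b; rewrite polarE => -[Ea Eb].
case: (det_i_sub B) EB => c d; rewrite polarE => -[Ec Ed].
have sA := cos2Dsin2 s; have sB := cos2Dsin2 t.
have eab : a ^+ 2 + b ^+ 2 = rA ^+ 2 * (p ^+ 2 + q ^+ 2).
  by rewrite -[RHS]mulr1 -sA Ea Eb; ring.
have ecd : c ^+ 2 + d ^+ 2 = rB ^+ 2 * (p ^+ 2 + q ^+ 2).
  by rewrite -[RHS]mulr1 -sB Ec Ed; ring.
have -> : a * d - b * c = rA * rB * (p ^+ 2 + q ^+ 2) * sin (t - s).
  by rewrite sinB Ea Eb Ec Ed; ring.
rewrite eab ecd exprMn.
rewrite (_ : rA ^+ 2 * _ * _ = (rA * rB * (p ^+ 2 + q ^+ 2)) ^+ 2); last by ring.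
apply: ler_wpM2l; first exact: sqr_ge0.
rewrite -[leLHS]real_normK ?num_real // -[leRHS]real_normK ?num_real //.
by rewrite ler_sqr ?nnegrE // norm_sin_le.
Qed.

(** Since [(i - A) (i + A) = - (1 + A^2)], the logarithmic derivative of
    [det (i - A)] is the trace of [(i + A) (1 + A^2)^-1 A']. *)
Lemma is_cderive_det_i_sub (A : V -> 'M[R]_n) A' x v :
  (A x)^T = A x ->
  (forall i j, is_derive x v (fun y => A y i j) (A' i j)) ->
  is_cderive x v (fun y => det_i_sub (A y)) (det_i_sub (A x) *
    (\tr (A' *m A x *m metric_inv (A x)) +i* \tr (metric_inv (A x) *m A'))).
Proof.
move=> As Ad; set S := metric_inv (A x).
pose M y := 'i%:M - emb (A y).
have Md i j : is_cderive x v (fun y => M y i j) ((- emb A') i j).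
  have -> : (- emb A') i j = 0 + (- A' i j)%:C by rewrite !mxE add0r rmorphN.
  under eq_fun do rewrite /M !mxE -rmorphN.
  apply: is_cderiveD; first exact: is_cderive_cst.
  by split; [exact: is_deriveN|exact: is_derive_cst].
have := is_cderive_det Md; congr is_cderive.
pose N := - (('i%:M + emb (A x)) *m emb S).
have MN : M x *m N = 1%:M.
  rewrite mulmxN mulmxA (_ : M x *m _ = - emb (1%:M + A x *m A x)).
    by rewrite mulNmx opprK -map_mxM mulmxV ?unitmx_1DAA // map_mx1.
  rewrite map_mxD map_mx1 map_mxM mulmxDr !mulmxBl -[X in _ + (X - _)]scalar_mxC.
  by rewrite addrA subrK -scalar_mxM -expr2 sqr_i opprD raddfN.
have -> : \adj (M x) = det_i_sub (A x) *: N.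
  by rewrite -[LHS]mulmx1 -MN mulmxA mul_adj_mx mul_scalar_mx.
rewrite -scalemxAr linearZ /=; congr (_ * _).
rewrite mulNmx mulmxN opprK mulmxDl mulmxDr linearD /=.
rewrite mul_scalar_mx -scalemxAr linearZ /= mulmxA -!map_mxM !trace_map_mx.
by rewrite (mxtrace_mulC A' S); simpc.
Qed.

(** With [z = det (i - A)], the imaginary part of [conj (z x) * z] has derivative
    [|z x|^2] times the trace, and by [det_i_sub_phase] its increments are at most
    [|z x| |z| L |h|].  Comparing squares keeps the moduli polynomial, so that
    their limit at [x] is immediate. *)
Lemma linearized_phase_bound (A : V -> 'M[R]_n) A' x v (r L : R) : 0 < r ->
  (forall h : R, `|h| < r -> (A (h *: v + x))^T = A (h *: v + x) /\
    `|lagrangian_phase (A (h *: v + x)) - lagrangian_phase (A x)| <= L * `|h|) ->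
  (forall i j, is_derive x v (fun y => A y i j) (A' i j)) ->
  `|\tr (metric_inv (A x) *m A')| <= L.
Proof.
move=> r0 AP Ad.
have As : (A x)^T = A x by have [] := AP 0; rewrite ?normr0 // scale0r add0r.
have L0 : 0 <= L.
  have [|_ LP] := AP (r / 2).
    by rewrite gtr0_norm ?divr_gt0 // [ltRHS]splitr ltrDl divr_gt0.
  have := le_trans (normr_ge0 _) LP; rewrite pmulr_lge0 // normr_gt0.
  by rewrite gt_eqF // divr_gt0.
have [] := is_cderive_det_i_sub As Ad.
have Npos := det_i_sub_neq0 As.
set alpha := \tr _; set tau := \tr _; set z := det_i_sub (A x) in Npos *.
pose a y := Re (det_i_sub (A y)); pose b y := Im (det_i_sub (A y)).
have [az bz] : Re z = a x /\ Im z = b x by [].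
have -> : Re (z * (alpha +i* tau)) = a x * alpha - b x * tau.
  by rewrite -az -bz; case: (z).
have -> : Im (z * (alpha +i* tau)) = a x * tau + b x * alpha.
  by rewrite -az -bz; case: (z).
rewrite {}az {}bz in Npos; rewrite -/a -/b => da db {z}.
set N := _ + _ in Npos.
(* The imaginary part of [conj (z x) * z y]. *)
pose G y := a x * b y - b x * a y.
have dG : is_derive x v G (N * tau).
  apply: is_derive_eq (is_deriveB (is_deriveZ (a x) db) (is_deriveZ (b x) da)) _.
  by rewrite /GRing.scale /= /N; ring.
have G0 : G x = 0 by rewrite /G mulrC subrr.
have cont f d : is_derive x v f d -> f (h *: v + x) @[h --> (0 : R)^'] --> f x.
  move=> [df _].
  suff : {for 0, continuous (fun h : R => f (h *: v + x))}.
    by move=> /continuous_withinNx; rewrite scale0r add0r.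
  exact/differentiable_continuous/derivable1_diffP/(derivable1P _ _ _).1.
have cN : N * (a (h *: v + x) ^+ 2 + b (h *: v + x) ^+ 2) * L ^+ 2
    @[h --> (0 : R)^'] --> N * N * L ^+ 2.
  apply: cvgMl; apply: cvgMr; apply: cvgD; rewrite -/(_ ^+ 2).
    by apply: cvgM; exact: cont da.
  by apply: cvgM; exact: cont db.
have cG : (h^-1 * G (h *: v + x)) ^+ 2 @[h --> (0 : R)^'] --> (N * tau) ^+ 2.
  have [dGx <-] := dG.
  have : (h^-1 *: (G (h *: v + x) - G x)) @[h --> (0 : R)^'] --> 'D_v G x by [].
  by rewrite G0; under eq_fun do rewrite subr0; move=> c; exact: cvgM.
have : (N * tau) ^+ 2 <= N * N * L ^+ 2.
  apply: (ler_cvg_to cG cN); apply/nbhs_ballP; exists r => //= h.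
  rewrite -ball_normE /= sub0r normrN => hr h0.
  have [Ahs] := AP h hr => ph.
  have := det_i_sub_phase As Ahs.
  rewrite (_ : N = Re (det_i_sub (A x)) ^+ 2 + Im (det_i_sub (A x)) ^+ 2) //.
  rewrite /G /a /b; case: (det_i_sub (A x)) => a0 b0; case: (det_i_sub _) => c d /=.
  move=> H; rewrite exprMn exprVn ler_pdivrMl ?exprn_even_gt0 //.
  rewrite (le_trans H) // [leRHS]mulrCA ler_wpM2l ?mulr_ge0 ?addr_ge0 ?sqr_ge0 //.
  rewrite mulrC -exprMn -[leLHS]real_normK ?num_real // -[leRHS]real_normK ?num_real //.
  by rewrite ler_sqr ?nnegrE // normrM (ger0_norm L0).
rewrite -expr2 exprMn ler_pM2l ?exprn_gt0 // => tL.
by rewrite -[L]ger0_norm // -ler_sqr ?nnegrE // !real_normK ?num_real.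
Qed.

End LinearizedPhase.

(** * Functions of several variables with continuous partial derivatives *)

Section InteriorEstimate.
Context {R : realType} {n : nat}.
Local Notation E := 'rV[R]_n.
Implicit Types (f u : E -> R) (x w : E) (Omega : set E).

Lemma open_ball_norm Omega x : open Omega -> Omega x ->
  exists2 r : R, 0 < r & forall y, `|y - x| < r -> Omega y.
Proof.
move=> Oo Ox; have /nbhs_normP[r /= r0 rP] : nbhs x Omega.
  exact: open_nbhs_nbhs.
by exists r => // y yx; apply: rP; rewrite /= distrC.
Qed.

Lemma CkW k Omega f : Ck k.+1 Omega f -> Ck k Omega f.
Proof.
elim: k f => [|k IH] f [cf df]; split=> // i.
by have [dfi Cf] := df i; split=> //; exact: IH.
Qed.

Lemma Ck_pderiv k Omega f i : Ck k.+1 Omega f -> Ck k Omega (pderiv i f).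
Proof. by move=> [_ /(_ i)[]]. Qed.

Lemma Ck_continuous k Omega f x : Ck k Omega f -> Omega x -> {for x, continuous f}.
Proof. by case: k => [|k] [cf _] Ox; apply: cf; rewrite inE. Qed.

(** The coordinate directions are added one at a time by [is_derive_dirD], so no
    total differential is needed. *)
Lemma C1_is_derive Omega f x w : open Omega -> Ck 1 Omega f -> Omega x ->
  is_derive x w f (\sum_j w 0 j * pderiv j f x).
Proof.
move=> Oo [_ df] Ox; rewrite {1}[w]row_sum_delta.
have [r r0 rP] := open_ball_norm Oo Ox.
elim: (index_enum _) => [|j s IH].
  by rewrite !big_nil; exact: is_derive0.
rewrite !big_cons addrC [X in is_derive _ _ _ X]addrC.
apply: (@is_derive_dirD _ _ f (fun y => w 0 j * pderiv j f y) _ _ _ _ r) => //.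
  move=> y /rP Oy; apply: is_deriveZdir; apply: derivableP.
  by have [+ _] := df j; apply.
have [_ C0] := df j.
have cj : {for x, continuous (pderiv j f)} by apply: C0.1; rewrite inE.
by apply: continuousM => //; exact: cst_continuous.
Qed.

Lemma pderiv_comm Omega f x i j : open Omega -> Ck 2 Omega f -> Omega x ->
  pderiv j (pderiv i f) x = pderiv i (pderiv j f) x.
Proof.
move=> Oo Cf Ox; have [r r0 rP] := open_ball_norm Oo Ox.
have C1 k l y : Omega y ->
    is_derive y 'e_l (pderiv k f) (pderiv l (pderiv k f) y).
  move=> Oy; apply: derivableP.
  by have [_ /(_ k)[_ [_ /(_ l)[+ _]]]] := Cf; apply.
have C0 k l : {for x, continuous (pderiv l (pderiv k f))}.
  by apply: (@Ck_continuous 0 Omega) => //; do 2 apply: Ck_pderiv.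
have D0 k y : Omega y -> is_derive y 'e_k f (pderiv k f y).
  by move=> Oy; apply: derivableP; have [_ /(_ k)[+ _]] := Cf; apply.
apply: (@mixed_derive_sym _ _ f (pderiv i f) (pderiv j f) _ _ x 'e_i 'e_j r) => //.
- by move=> y /rP; exact: D0.
- by move=> y /rP; exact: D0.
- by move=> y /rP; exact: C1.
- by move=> y /rP; exact: C1.
Qed.

Lemma hessian_sym Omega u x : open Omega -> Ck 2 Omega u -> Omega x ->
  (hessian u x)^T = hessian u x.
Proof.
by move=> Oo Cu Ox; apply/matrixP => i j; rewrite !mxE; exact: pderiv_comm Ox.
Qed.

(** Two transpositions: the outer derivative is only moved past [pderiv i] once
    the inner two have been exchanged on a neighbourhood of [x]. *)
Lemma pderiv_hessian_comm Omega u x i j l : open Omega -> Ck 3 Omega u -> Omega x ->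
  pderiv l (pderiv j (pderiv i u)) x = pderiv i (pderiv l (pderiv j u)) x.
Proof.
move=> Oo Cu Ox.
have -> : pderiv l (pderiv j (pderiv i u)) x = pderiv l (pderiv i (pderiv j u)) x.
  apply: near_eq_derive; have : nbhs x Omega by exact: open_nbhs_nbhs.
  by apply: filterS => y Oy; apply: pderiv_comm Oy => //; exact: CkW.
by apply: pderiv_comm Ox => //; exact: Ck_pderiv.
Qed.

Lemma eucl_norm_sq w : eucl_norm w ^+ 2 = (w *m w^T) 0 0.
Proof.
rewrite sqr_sqrtr ?sumr_ge0 // => [|i _]; last exact: sqr_ge0.
by rewrite mxE; apply: eq_bigr => i _; rewrite mxE expr2.
Qed.

Lemma eucl_normZ (c : R) w : eucl_norm (c *: w) = `|c| * eucl_norm w.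
Proof.
rewrite /eucl_norm -sqrtr_sqr -sqrtrM ?sqr_ge0 // mulr_sumr.
by congr Num.sqrt; apply: eq_bigr => i _; rewrite mxE exprMn.
Qed.

(** The term [u^2] is what makes the maximum principle work: its second derivative
    contributes the square of the gradient. *)
Definition energy u x : R := (eucl_norm (grad u x) ^+ 2 + u x ^+ 2) / 2.

Lemma energyE u : energy u =
  fun x => (\sum_i pderiv i u x * pderiv i u x + u x * u x) * 2^-1.
Proof.
apply/funext => x; rewrite /energy eucl_norm_sq mxE.
by under eq_bigr do rewrite !mxE.
Qed.

Lemma continuous_energy Omega u x : Ck 1 Omega u -> Omega x ->
  {for x, continuous (energy u)}.
Proof.
move=> Cu Ox; have cu := Ck_continuous Cu Ox.
rewrite energyE; apply: continuousM; last exact: cst_continuous.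
apply: continuousD; last exact: continuousM.
elim: (index_enum _) => [|i s IH].
  rewrite (_ : (fun _ => _) = cst 0); first exact: cst_continuous.
  by apply/funext => y; rewrite big_nil.
rewrite (_ : (fun _ => _) = (fun y => pderiv i u y * pderiv i u y) +
  (fun y => \sum_(j <- s) pderiv j u y * pderiv j u y)); last first.
  by apply/funext => y; rewrite big_cons.
apply: continuousD IH.
by apply: continuousM; exact: (Ck_continuous (Ck_pderiv i Cu)).
Qed.

Lemma quadE (H : 'M[R]_n) w : quad H w = \sum_j \sum_l w 0 j * w 0 l * H j l.
Proof.
rewrite /quad mxE exchange_big /=; apply: eq_bigr => l _.
rewrite !mxE mulr_suml; apply: eq_bigr => j _; ring.
Qed.

Lemma is_derive_bigsum (I : Type) (s : seq I) (f : I -> E -> R) x w d :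
  (forall i, is_derive x w (f i) (d i)) ->
  is_derive x w (fun y => \sum_(i <- s) f i y) (\sum_(i <- s) d i).
Proof.
move=> fd; elim: s => [|i s IH].
  by rewrite big_nil; under eq_fun do rewrite big_nil; exact: is_derive_cst.
rewrite big_cons; under eq_fun do rewrite big_cons; exact: is_deriveD.
Qed.

Lemma is_derive_energy Omega u x w : open Omega -> Ck 2 Omega u -> Omega x ->
  is_derive x w (energy u)
    (((grad u x *m hessian u x + u x *: grad u x) *m w^T) 0 0).
Proof.
move=> Oo Cu Ox.
have C1u : Ck 1 Omega u by exact: CkW.
rewrite energyE.
have dS := is_derive_bigsum (index_enum 'I_n) (fun i => is_deriveM
  (C1_is_derive w Oo (Ck_pderiv i Cu) Ox)
  (C1_is_derive w Oo (Ck_pderiv i Cu) Ox)).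
have dU := C1_is_derive w Oo C1u Ox.
have dP := is_deriveM (is_deriveD dS (is_deriveM dU dU)) (is_derive_cst (2^-1 : R) x w).
apply: is_derive_eq dP _.
rewrite scaler0 add0r /GRing.scale /=.
rewrite (eq_bigr (fun i => 2 * (pderiv i u x * \sum_j w 0 j * pderiv j (pderiv i u) x)));
  last by move=> i _; ring.
rewrite -mulr_sumr.
rewrite (_ : 2^-1 * _ = (\sum_i pderiv i u x * \sum_j w 0 j * pderiv j (pderiv i u) x)
  + u x * \sum_j w 0 j * pderiv j u x); last by field.
rewrite mulmxDl -scalemxAl [RHS]mxE [X in _ = _ + X]mxE; congr (_ + _ * _); last first.
  by rewrite mxE; apply: eq_bigr => j _; rewrite !mxE mulrC.
rewrite -mulmxA mxE; apply: eq_bigr => i _; rewrite !mxE; congr (_ * _).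
by apply: eq_bigr => j _; rewrite !mxE mulrC.
Qed.

End InteriorEstimate.

(** * The gradient at an interior maximum of the energy *)

Section MaximumPrinciple.
Context {R : realType} {n : nat}.
Local Notation E := 'rV[R]_n.
Implicit Types (f u theta : E -> R) (x w : E) (Omega : set E).

Definition dhessian u x w : 'M[R]_n :=
  \matrix_(i, j) \sum_k w 0 k * pderiv k (pderiv j (pderiv i u)) x.

Lemma is_derive_hessian Omega u x w i j : open Omega -> Ck 3 Omega u -> Omega x ->
  is_derive x w (fun y => hessian u y i j) (dhessian u x w i j).
Proof.
move=> Oo Cu Ox; under eq_fun do rewrite mxE.
by rewrite mxE; apply: C1_is_derive Ox => //; do 2 apply: Ck_pderiv.
Qed.

(** Symmetry of the third derivatives turns [g_i D_w D_w u_i] into the derivative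
    of the Hessian in the direction of the gradient [g]. *)
Lemma is_derive2_energy Omega u x w : open Omega -> Ck 3 Omega u -> Omega x ->
  is_derive x w
    (fun y => ((grad u y *m hessian u y + u y *: grad u y) *m w^T) 0 0)
    (quad (hessian u x *m hessian u x + dhessian u x (grad u x) +
      (grad u x)^T *m grad u x + u x *: hessian u x) w).
Proof.
move=> Oo Cu Ox; set A := hessian u x; set g := grad u x.
have As : A^T = A by apply: hessian_sym Ox => //; exact: CkW.
have C1u : Ck 1 Omega u by do 2 apply: CkW.
have C1g i : Ck 1 Omega (pderiv i u) by apply: CkW; exact: Ck_pderiv.
have -> : (fun y => ((grad u y *m hessian u y + u y *: grad u y) *m w^T) 0 0) =
    fun y => \sum_i pderiv i u y * (\sum_j w 0 j * hessian u y i j) +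
      u y * \sum_j w 0 j * pderiv j u y.
  apply/funext => y; rewrite mulmxDl -scalemxAl [LHS]mxE [X in _ + X = _]mxE.
  rewrite -mulmxA mxE; congr (_ + _ * _).
    apply: eq_bigr => i _; rewrite !mxE; congr (_ * _).
    by apply: eq_bigr => j _; rewrite !mxE mulrC.
  by rewrite mxE; apply: eq_bigr => j _; rewrite !mxE mulrC.
have dwA i := is_derive_bigsum (index_enum 'I_n) (fun j => is_deriveM
  (is_derive_cst (w 0 j) x w) (is_derive_hessian w i j Oo Cu Ox)).
have dwg := is_derive_bigsum (index_enum 'I_n) (fun j => is_deriveM
  (is_derive_cst (w 0 j) x w) (C1_is_derive w Oo (C1g j) Ox)).
have dgA := is_derive_bigsum (index_enum 'I_n) (fun i => is_deriveM
  (C1_is_derive w Oo (C1g i) Ox) (dwA i)).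
have dU := is_deriveM (C1_is_derive w Oo C1u Ox) dwg.
apply: is_derive_eq (is_deriveD dgA dU) _.
rewrite /GRing.scale /=.
have quadD (H K : 'M[R]_n) : quad (H + K) w = quad H w + quad K w.
  by rewrite /quad mulmxDr mulmxDl mxE.
have quadZ (c : R) (H : 'M[R]_n) : quad (c *: H) w = c * quad H w.
  by rewrite /quad -scalemxAr -scalemxAl mxE.
have wA i : \sum_j w 0 j * A i j = (w *m A) 0 i.
  by rewrite mxE; apply: eq_bigr => j _; rewrite -{1}As mxE.
have wg : \sum_j w 0 j * pderiv j u x = (w *m g^T) 0 0.
  by rewrite mxE; apply: eq_bigr => j _; rewrite !mxE.
rewrite 3!quadD quadZ -{2}As quad_sq.
have -> : quad (g^T *m g) w = (w *m g^T) 0 0 * (w *m g^T) 0 0.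
  by rewrite -{2}[g]trmxK quad_sq mxE big_ord1 [(w *m _)^T _ _]mxE.
have HE i : \sum_j w 0 j * pderiv j (pderiv i u) x = (w *m A) 0 i.
  by rewrite -wA; apply: eq_bigr => j _; rewrite mxE.
transitivity (\sum_i (pderiv i u x * (\sum_j w 0 j * dhessian u x w i j) +
    (w *m A) 0 i * (w *m A) 0 i) +
    (u x * (\sum_i w 0 i * (w *m A) 0 i) + (w *m g^T) 0 0 * (w *m g^T) 0 0)).
  congr (_ + _); first apply: eq_bigr => i _.
    rewrite HE -wA; congr (_ * _ + _).
    by apply: eq_bigr => j _; rewrite mulr0 addr0.
  rewrite -wg; congr (_ * _ + _).
  by apply: eq_bigr => j _; rewrite mulr0 addr0 HE.
rewrite big_split /= addrA.
have -> : \sum_i (w *m A) 0 i * (w *m A) 0 i = (w *m A *m (w *m A)^T) 0 0.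
  by rewrite [RHS]mxE; apply: eq_bigr => j _; rewrite [(w *m A)^T _ _]mxE.
have -> : \sum_i w 0 i * (w *m A) 0 i = quad A w.
  rewrite /quad [RHS]mxE; apply: eq_bigr => j _.
  by rewrite [w^T _ _]mxE mulrC.
suff -> : \sum_i pderiv i u x * (\sum_j w 0 j * dhessian u x w i j) =
    quad (dhessian u x g) w by ring.
rewrite quadE; under eq_bigr do rewrite mulr_sumr.
rewrite exchange_big /=; apply: eq_bigr => j _.
under eq_bigr do rewrite mxE !mulr_sumr.
rewrite exchange_big /=; apply: eq_bigr => l _.
rewrite mxE mulr_sumr; apply: eq_bigr => i _.
by rewrite [g 0 i]mxE (pderiv_hessian_comm i j l Oo Cu Ox); ring.
Qed.

(** At an interior maximum of the energy the terms of second order in [D^2 u]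
    are nonnegative, and the quadratic term [|Du|^2 / (1 + u^2)] has to be
    compensated by the derivative of the phase and by the zeroth order term. *)
Lemma energy_max_gradient_bound Omega u theta x (M K : R) :
  open Omega -> Ck 3 Omega u -> Omega x ->
  (forall y, Omega y -> lagrangian_phase (hessian u y) = theta y) ->
  (forall y, Omega y -> `|theta y - theta x| <= K * eucl_norm (y - x)) ->
  (forall y, Omega y -> energy u y <= energy u x) ->
  0 <= K -> `|u x| <= M ->
  eucl_norm (grad u x) <= 1 + (1 + M ^+ 2) * (K + M * n%:R).
Proof.
move=> Oo Cu Ox thetaE thetaL umax K0 uM.
set g := grad u x; set A := hessian u x.
have M0 : 0 <= M := le_trans (normr_ge0 _) uM.
have As y : Omega y -> (hessian u y)^T = hessian u y.
  by move=> Oy; apply: hessian_sym Oy => //; exact: CkW.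
have [r r0 rP] := open_ball_norm Oo Ox.
have test w := @second_derivative_test _ _ (energy u) _ x w _ r r0
  (fun y yr => is_derive_energy w Oo (CkW Cu) (rP y yr))
  (is_derive2_energy w Oo Cu Ox) (fun y yr => umax y (rP y yr)).
(* The first derivative vanishes in every direction, in particular in the
   direction of [g A + u g] itself. *)
have gA : g *m A = - u x *: g.
  apply/eqP; rewrite scaleNr -subr_eq0 opprK; apply/eqP.
  by apply: rowdot_eq0; have [] := test (g *m A + u x *: g).
have := metric_inv_gradient_bound (As _ Ox) gA (fun w => (test w).2).
rewrite -eucl_norm_sq -/g -/A; set G := eucl_norm g.
have G0 : 0 <= G by exact: sqrtr_ge0.
have : `|\tr (metric_inv A *m dhessian u x g)| <= K * G.
  pose m := `|g| + 1; have m0 : 0 < m by rewrite ltr_wpDl.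
  apply: (@linearized_phase_bound _ _ _ (hessian u) _ x g (r / m)).
  - exact: divr_gt0.
  - move=> h; rewrite ltr_pdivlMr // => hr.
    have Oh : Omega (h *: g + x).
      apply: rP; rewrite addrK normrZ (le_lt_trans _ hr) // ler_wpM2l //.
      by rewrite lerDl.
    split; first exact: As.
    rewrite !thetaE // (le_trans (thetaL _ Oh)) // addrK eucl_normZ.
    by rewrite mulrA mulrAC.
  - by move=> i j; exact: is_derive_hessian Ox.
move=> trB bound.
have u2 : u x ^+ 2 <= M ^+ 2.
  by rewrite -[leLHS]real_normK ?num_real // ler_sqr ?nnegrE.
have u0 : 0 < 1 + u x ^+ 2 by rewrite ltr_wpDr // sqr_ge0.
have n0 : 0 <= n%:R :> R by [].
have {trB}bound : G ^+ 2 / (1 + u x ^+ 2) <= K * G + M * n%:R.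
  apply: (le_trans bound); apply: lerD => //.
  by apply: ler_pM => //; lra.
have {bound} : G ^+ 2 <= (1 + M ^+ 2) * (K * G + M * n%:R).
  move: bound; rewrite ler_pdivrMr // => /le_trans; apply.
  rewrite mulrC ler_wpM2r ?lerD2l // addr_ge0 // mulr_ge0 //.
have [G1 _|/ltW G1 bound] := leP G 1.
  by rewrite (le_trans G1) // lerDl mulr_ge0 // ?addr_ge0 ?mulr_ge0 ?sqr_ge0.
have G0' : 0 < G by exact: lt_le_trans G1.
rewrite ler_wpDl // -(ler_pM2r G0') -expr2 (le_trans bound) //.
rewrite -mulrA ler_wpM2l ?addr_ge0 ?sqr_ge0 // mulrDl lerD2l.
by rewrite ler_peMr // mulr_ge0.
Qed.

End MaximumPrinciple.

(** * From the boundary to the interior *)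

Section FromBoundaryToInterior.
Context {R : realType} {n : nat}.
Local Notation E := 'rV[R]_n.
Implicit Types (u theta : E -> R) (x y : E) (Omega : set E).

Lemma sup_norm_le A u (M : R) : (sup_norm A u <= M%:E)%E ->
  forall x, A x -> `|u x| <= M.
Proof.
move=> /ereal_supP uM x Ax; rewrite -lee_fin; apply: uM.
by exists x.
Qed.

Lemma lip_const_le A u (K : R) : (lip_const A u <= K%:E)%E ->
  forall x y, A x -> A y -> `|u x - u y| <= K * eucl_norm (x - y).
Proof.
move=> /ereal_supP uK x y Ax Ay.
have [e0|n0] := eqVneq (eucl_norm (x - y)) 0.
  have /rowdot_eq0/eqP : ((x - y) *m (x - y)^T) 0 0 = 0.
    by rewrite -eucl_norm_sq e0 expr0n.
  by rewrite e0 mulr0 subr_eq0 => /eqP->; rewrite subrr normr0.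
rewrite -ler_pdivrMr ?lt_def ?n0 ?sqrtr_ge0 // -lee_fin; apply: uK.
by exists (x, y).
Qed.

Lemma boundaryP Omega x : open Omega ->
  boundary Omega x <-> closure Omega x /\ ~ Omega x.
Proof. by move=> /interior_id Oo; rewrite /boundary Oo. Qed.

Lemma bounded_subset (A B : set E) : A `<=` B -> bounded_set B -> bounded_set A.
Proof.
move=> AB; rewrite /bounded_near => -[N [Nr NP]]; exists N; split => // m /NP Bm x Ax.
exact/Bm/AB.
Qed.

(** Otherwise [Omega] would be compact, and a coordinate would attain on the open
    set [Omega] its maximum. *)
Lemma boundary_nonempty Omega : (0 < n)%N -> bounded_domain Omega ->
  boundary Omega !=set0.
Proof.
move=> n0 [ O0 Oo _ Ob]; apply: contrapT => /set0P/negP; rewrite negbK => /eqP B0.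
have Oc : closed Omega.
  move=> x clx; apply: contrapT => Ox.
  have : boundary Omega x by apply/boundaryP.
  by rewrite B0.
pose i : 'I_n := Ordinal n0.
have [c] := @EVT_max_rV R n (fun x => x 0 i) Omega O0 (bounded_closed_compact Ob Oc)
  (continuous_subspaceT (@coord_continuous _ _ _ _ _)).
rewrite inE => Occ cmax; have [r r0 rP] := open_ball_norm Oo Occ.
pose m := `|'e_i : E| + 1; have m0 : 0 < m by rewrite ltr_wpDl.
have h0 : 0 < r / m / 2 by rewrite !divr_gt0.
have /mem_set/cmax : Omega ((r / m / 2) *: 'e_i + c).
  apply: rP; rewrite addrK normrZ gtr0_norm //.
  rewrite (@le_lt_trans _ _ (r / m / 2 * m)) // ?ler_pM2l ?lerDl //.
  by rewrite mulrAC divfK ?gt_eqF // [ltRHS]splitr ltrDl divr_gt0.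
by rewrite !mxE !eqxx mulr1 gerDr leNgt h0.
Qed.

(** Where the energy is at least its value at a point beyond the claimed bound,
    the gradient exceeds the bound [b] valid near the boundary, so this superlevel
    set is compact and the energy attains its maximum over [Omega] on it. *)
Lemma gradient_maximum_principle Omega u (M b C1 : R) :
  open Omega -> bounded_set Omega -> Ck 1 Omega u ->
  (forall y, Omega y -> `|u y| <= M) -> 0 <= b ->
  (forall x, boundary Omega x ->
    exists2 V, nbhs x V & forall y, V y -> Omega y -> eucl_norm (grad u y) <= b) ->
  (forall x, Omega x -> (forall y, Omega y -> energy u y <= energy u x) ->
    eucl_norm (grad u x) <= C1) ->
  forall y, Omega y -> eucl_norm (grad u y) <= Num.max b C1 + M.
Proof.
move=> Oo Ob Cu uM b0 bdb maxC1 y0 Oy0; rewrite leNgt; apply/negP => big.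
have M0 : 0 <= M := le_trans (normr_ge0 _) (uM _ Oy0).
have u2 y : Omega y -> u y ^+ 2 <= M ^+ 2.
  by move=> /uM uy; rewrite -[leLHS]real_normK ?num_real // ler_sqr ?nnegrE.
set m := Num.max b C1 in big.
have m0 : 0 <= m by rewrite le_max b0.
have big2 : m ^+ 2 + M ^+ 2 < eucl_norm (grad u y0) ^+ 2.
  apply: (@le_lt_trans _ _ ((m + M) ^+ 2)).
    by rewrite sqrrD addrAC lerDl mulrn_wge0 // mulr_ge0.
  by rewrite ltr_pXn2r ?nnegrE ?sqrtr_ge0 ?addr_ge0.
pose S := [set y | Omega y /\ energy u y0 <= energy u y].
have gradS y : S y -> m < eucl_norm (grad u y).
  move=> [ Oy]; rewrite /energy ler_pM2r ?invr_gt0 // => Ey.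
  rewrite -(@ltr_pXn2r _ 2) ?nnegrE ?sqrtr_ge0 //.
  have := u2 _ Oy; have := sqr_ge0 (u y0); lra.
have cE y : Omega y -> {for y, continuous (energy u)}.
  exact: continuous_energy.
have Sc : closed S.
  move=> x clx; have clO : closure Omega x by apply: closure_subset clx => y [].
  have [ Ox|Ox] := pselect (Omega x).
    split=> //; rewrite leNgt; apply/negP => lt.
    have : nbhs x (energy u @^-1` [set t | t < energy u y0]).
      apply: (cE _ Ox); exact: open_nbhs_nbhs (conj (@open_lt _ _) lt).
    by move=> /clx[y [[_ Sy] /=]]; rewrite ltNge Sy.
  have [|V nV VP] := bdb x; first by apply/boundaryP.
  have [y [Sy Vy]] := clx _ nV.
  have := VP _ Vy Sy.1; rewrite leNgt => /negP; elim.
  by apply: le_lt_trans (gradS _ Sy); rewrite le_max lexx.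
have Scomp : compact S.
  by apply: bounded_closed_compact => //; apply: bounded_subset Ob => y [].
have Scont : {within S, continuous (energy u)}.
  by apply: continuous_in_subspaceT => y; rewrite inE => -[/cE].
have [c] := @EVT_max_rV R n (energy u) S (ex_intro _ y0 (conj Oy0 (lexx _))) Scomp Scont.
rewrite inE => -[ Oc y0c] cmax.
have : eucl_norm (grad u c) <= C1.
  apply: maxC1 => // y Oy; have [yS|/ltW yS] := leP (energy u y0) (energy u y).
    by apply: cmax; rewrite inE.
  exact: le_trans yS y0c.
rewrite leNgt => /negP; apply; apply: le_lt_trans (gradS c (conj Oc y0c)).
by rewrite le_max lexx orbT.
Qed.

Lemma boundary_gradient_local_bound Omega u x (b : R) : open Omega ->
  boundary Omega x -> (grad_norm Omega u x < b%:E)%E ->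
  exists2 V, nbhs x V & forall y, V y -> Omega y -> eucl_norm (grad u y) <= b.
Proof.
move=> Oo /(boundaryP _ Oo)[clx Ox]; rewrite /grad_norm memNset //.
move=> /ereal_inf_lt[_ [V VO <-]] Vb.
exists [set y | Omega y -> V y]; first exact: VO.
move=> y Vy /Vy {}Vy; rewrite -lee_fin (le_trans _ (ltW Vb)) //.
by apply: ereal_sup_ubound; exists y.
Qed.

Lemma boundary_grad_norm_ge0 Omega u x : open Omega -> boundary Omega x ->
  (0 <= grad_norm Omega u x)%E.
Proof.
move=> Oo /(boundaryP _ Oo)[clx Ox]; rewrite /grad_norm memNset //.
apply: limf_esup_ge0 => [|y]; last by rewrite lee_fin sqrtr_ge0.
by have [] := within_nbhs_proper clx.
Qed.

End FromBoundaryToInterior.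

Theorem lemma4p1 (R : realType) (n : nat) (M K : R) : (3 <= n)%N ->
  exists C : R,
    forall (Omega : set 'rV[R]_n) (phi theta u : 'rV[R]_n -> R),
    bounded_domain Omega ->
    C01 (boundary Omega) phi ->
    C01 (closure Omega) theta ->
    (forall x, closure Omega x ->
       - (n%:R * pi / 2) < theta x < n%:R * pi / 2) ->
    Ck 3 Omega u ->
    C01 (closure Omega) u ->
    (forall x, Omega x -> lagrangian_phase (hessian u x) = theta x) ->
    (forall x, boundary Omega x -> u x = phi x) ->
    (sup_norm (closure Omega) u <= M%:E)%E ->
    (C01_norm (closure Omega) theta <= K%:E)%E ->
    (ereal_sup [set grad_norm Omega u x | x in closure Omega]
     <= C%:E * (1 + ereal_sup [set grad_norm Omega u x | x in boundary Omega]))%E.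
Proof.
move=> n3; pose C1 := 1 + (1 + M ^+ 2) * (K + M * n%:R).
(* [C1] bounds the gradient at interior maxima of the energy; returning from the
   energy to the gradient costs another [M]. *)
exists (1 + C1 + M) => Omega phi theta u dom _ _ _ Cu _ thetaE _ supu normtheta.
have [[p Op] Oo _ Ob] := dom; have subcl := @subset_closure _ Omega.
have uM x : Omega x -> `|u x| <= M by move=> /subcl; exact: sup_norm_le supu x.
have M0 : 0 <= M := le_trans (normr_ge0 _) (uM _ Op).
have supt : (0 <= sup_norm (closure Omega) theta)%E.
  apply: (@le_trans _ _ `|theta p|%:E); first by rewrite lee_fin.
  by apply: ereal_sup_ubound; exists p => //; exact: subcl.
have lipt : (lip_const (closure Omega) theta <= K%:E)%E.
  by apply: le_trans normtheta; rewrite /C01_norm leeDr.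
have K0 : 0 <= K.
  rewrite -lee_fin (le_trans _ lipt) //.
  apply: ereal_sup_ubound; exists (p, p); first by split; exact: subcl.
  by rewrite /= subrr normr0 mul0r.
have C10 : 0 <= C1.
  by rewrite /C1 addr_ge0 // mulr_ge0 ?addr_ge0 ?mulr_ge0 ?sqr_ge0.
have [q bq] := boundary_nonempty (ltnW (ltnW n3)) dom.
set B := ereal_sup [set _ | _ in boundary _].
have Bub x : boundary Omega x -> (grad_norm Omega u x <= B)%E.
  by move=> bx; apply: ereal_sup_ubound; exists x.
have : (0 <= B)%E := le_trans (boundary_grad_norm_ge0 u Oo bq) (Bub _ bq).
have CM0 : 0 < 1 + C1 + M by rewrite -addrA ltr_wpDr // addr_ge0.
case: B Bub => [b| |] // Bub; last by move=> _; rewrite addey // gt0_muley ?lte_fin // leey.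
rewrite lee_fin => b0.
have bC : b + C1 + M <= (1 + C1 + M) * (1 + b).
  have <- : b + C1 + M + (1 + (C1 + M) * b) = (1 + C1 + M) * (1 + b) by ring.
  by rewrite lerDl !addr_ge0 // mulr_ge0 // addr_ge0.
(* The limsup at a boundary point gives local bounds only by numbers larger than
   [b], whence the slack [e]. *)
have Osup x : Omega x -> eucl_norm (grad u x) <= b + C1 + M.
  move=> Ox; apply/ler_addgt0Pr => e e0.
  have be0 : 0 <= b + e by rewrite addr_ge0 // ltW.
  apply: le_trans (gradient_maximum_principle Oo Ob (CkW (CkW Cu)) uM be0 _ _ Ox) _.
  - move=> y By; apply: (boundary_gradient_local_bound Oo By).
    by apply: le_lt_trans (Bub _ By) _; rewrite lte_fin ltrDl.
  - move=> y Oy ymax; apply: (energy_max_gradient_bound Oo Cu Oy thetaE _ ymax K0 (uM _ Oy)).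
    by move=> z Oz; apply: (lip_const_le lipt); exact: subcl.
  rewrite addrAC lerD2r ge_max; apply/andP; split; last first.
    by rewrite addrAC lerDr.
  by rewrite addrAC lerDl.
apply/ereal_supP => _ [x clx <-].
rewrite -EFinD -EFinM; have [Ox|Ox] := pselect (Omega x).
  rewrite /grad_norm mem_set // lee_fin (le_trans (Osup _ Ox)) //.
apply: (le_trans (Bub x _)); first by apply/boundaryP.
rewrite lee_fin (le_trans _ bC) // -addrA lerDl addr_ge0 //.
Qed.
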